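(* Let $n\ge2$ be an integer and for each $p\in[0,1]$ let $B_{n,p}\sim\mathrm{Bin}(n,p)$. Then the mapping $p\mapsto\mathbb{P}(B_{n,p}>np-p)$ is increasing on the set $p\in\{\tfrac{1}{n-1},\tfrac{2}{n-1},\ldots,\tfrac{n-2}{n-1}\}$, and the mapping $p\mapsto\mathbb{P}(B_{n,p}>np-(1-p))$ is decreasing on the set $p\in\{\tfrac{1}{n+1},\tfrac{2}{n+1},\ldots,\tfrac{n}{n+1}\}$.
   Context: $\mathrm{Bin}(n,p)$ is the Binomial distribution: $\mathbb{P}(B_{n,p}=k)=\binom{n}{k}p^k(1-p)^{n-k}$ for $k=0,\ldots,n$. ''Increasing'' and ''decreasing'' are meant in the weak (non-strict) sense. For $n=2$ the first set is empty. *)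

(* Defs.v *)
From HB Require Import structures.
From mathcomp Require Export all_boot all_order all_algebra.
From mathcomp Require Export all_classical all_reals all_analysis.

Set Implicit Arguments.
Unset Strict Implicit.
Unset Printing Implicit Defensive.

Import Order.TTheory GRing.Theory Num.Theory.
Import numFieldNormedType.Exports.

Local Open Scope classical_set_scope.
Local Open Scope ring_scope.

(* X ~ Bin(n, p).  For p outside [0, 1] the library's [binomial_prob n p] is
   the Dirac mass at 0, so this is meaningful only under 0 <= p <= 1. *)
Definition binomial_rv (R : realType) (d : measure_display)
    (T : measurableType d) (P : probability T R) (n : nat) (p : R)
    (X : {RV P >-> nat}) : Prop :=
  distribution P X = binomial_prob n p :> (set nat -> \bar R).

(* Main.v *)
(* Write T_k(p) = P(Bin(n, p) >= k), a polynomial with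
   T_(k+1)' = (n - k) C(n, k) p^k (1 - p)^(n - k - 1).  Each half of the theorem
   compares T_(k+1) at the right end q of an interval [p, q] with T_k at its left
   end p, where c p = d - 1 and c q = d: (c, d) = (n + 1, k + 1) for the second
   half and (n - 1, k) for the first.  The polynomial
     W(t) = (c t - d) C(n, k) t^k (1 - t)^(n - k) - T_(k+1)(t)
   equals - T_k(p) at p and - T_(k+1)(q) at q, and W' is a nonnegative multiple
   of the quadratic c t (1 - t) + (c t - d) (k - n t) - (n - k) t.  The latter is
   ((n + 1) t - k) (k + 1 - (n + 1) t) >= 0 on [p, q] in the second case, and
   - (n t - k)^2 - t (1 - t) <= 0 in the first. *)
Require Import Defs.
From mathcomp Require Import all_boot all_order all_algebra.
From mathcomp Require Import all_classical all_reals all_analysis.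
From mathcomp Require Import polyrcf ring lra zify.

Set Implicit Arguments.
Unset Strict Implicit.
Unset Printing Implicit Defensive.

Import Order.TTheory GRing.Theory Num.Theory.
Import numFieldNormedType.Exports.

Local Open Scope classical_set_scope.
Local Open Scope ring_scope.

(** A formal polynomial in the success probability, so that differentiation is algebraic and
    monotonicity follows from the sign of [deriv] over a real closed field. *)
Definition binomial_tail (R : nzRingType) (n k : nat) : {poly R} :=
  \sum_(k <= j < n.+1) ('X^j * (1 - 'X) ^+ (n - j)) *+ 'C(n, j).

Lemma binomial_tail_recl (R : nzRingType) (n k : nat) : (k <= n)%N ->
  binomial_tail R n k =
  ('X^k * (1 - 'X) ^+ (n - k)) *+ 'C(n, k) + binomial_tail R n k.+1.
Proof. by move=> kn; rewrite /binomial_tail big_ltn. Qed.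

Lemma deriv_XnMonem (R : comNzRingType) (a b : nat) :
  deriv ('X^a * (1 - 'X) ^+ b : {poly R}) =
  ('X^(a.-1) * (1 - 'X) ^+ b) *+ a - ('X^a * (1 - 'X) ^+ b.-1) *+ b.
Proof.
rewrite derivM derivXn deriv_exp derivB derivX derivC sub0r mulN1r.
by rewrite mulrnAl mulNrn mulrN mulrnAr.
Qed.

(** The sum telescopes: in the derivative of the lowest term, the part from [(1 - 'X)] cancels the
    derivative of the remaining tail, and the other part is rewritten by (k + 1) C(n, k + 1) = (n -
    k) C(n, k). At [m = 0] the truncated [m.-1] is harmless, as the coefficient vanishes. *)
Lemma deriv_binomial_tail (R : comNzRingType) (k m : nat) :
  deriv (binomial_tail R (k + m) k.+1) =
  ('X^k * (1 - 'X) ^+ m.-1) *+ (m * 'C(k + m, k)).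
Proof.
elim: m k => [|m IH] k.
  by rewrite /binomial_tail addn0 big_geq// deriv0 mul0n mulr0n.
rewrite binomial_tail_recl ?addnS ?ltnS ?leq_addr// -addSn derivD IH derivMn.
rewrite addKn deriv_XnMonem/= mulrnBl -!mulrnA addrNK mul_bin_left.
by rewrite addSnnS addKn.
Qed.

(* The polynomial W of the header, with k = a + 1 and n - k = m + 1. *)
Definition tail_barrier (R : comNzRingType) (a m : nat) (c d : R) : {poly R} :=
  (c *: 'X - d%:P) * ('X^(a.+1) * (1 - 'X) ^+ m.+1) *+ 'C(a.+1 + m.+1, a.+1)
  - binomial_tail R (a.+1 + m.+1) a.+2.

(** T_(k+1)' carries the same C(n, k) as the first term of W, so everything factors, and the sign on
    [0, 1] is left to the quadratic. *)
Lemma horner_deriv_tail_barrier (R : comNzRingType) (a m : nat) (c d t : R) :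
  (deriv (tail_barrier a m c d)).[t] =
  t ^+ a * (1 - t) ^+ m *+ 'C(a.+1 + m.+1, a.+1) *
  (c * t * (1 - t) + (c * t - d) * (a.+1%:R - (a + m).+2%:R * t)
   - m.+1%:R * t).
Proof.
rewrite derivB deriv_binomial_tail derivMn derivM deriv_XnMonem.
rewrite derivB derivZ derivX derivC subr0 /=.
rewrite !(horner_exp, hornerMn, hornerM, hornerD, hornerN).
rewrite !(hornerZ, hornerX, hornerC) mulnC mulrnA.
by move: 'C(a.+1 + m.+1, a.+1) => C; rewrite !exprS; ring.
Qed.

Lemma tail_barrier_left (R : comNzRingType) (a m : nat) (c d p : R) :
  c * p = d - 1 ->
  (tail_barrier a m c d).[p] = - (binomial_tail R (a.+1 + m.+1) a.+1).[p].
Proof.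
move=> cp; rewrite [in RHS]binomial_tail_recl ?leq_addr// addKn.
rewrite !(hornerMn, hornerM, hornerD, hornerN) hornerZ hornerX hornerC cp.
by rewrite opprD addrAC subrr add0r mulN1r mulNrn.
Qed.

Lemma tail_barrier_right (R : comNzRingType) (a m : nat) (c d q : R) :
  c * q = d ->
  (tail_barrier a m c d).[q] = - (binomial_tail R (a.+1 + m.+1) a.+2).[q].
Proof.
move=> cq; rewrite !(hornerMn, hornerM, hornerD, hornerN).
rewrite hornerZ hornerX hornerC cq.
by rewrite subrr mul0r mul0rn sub0r.
Qed.

Lemma binomial_tail_mean_step (R : rcfType) (n k : nat) :
  (0 < k < n)%N ->
  (binomial_tail R n k.+1).[k.+1%:R / (n%:R + 1)] <=
  (binomial_tail R n k).[k%:R / (n%:R + 1)].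
Proof.
case: k => // a /andP[_ an]; have [m ->] : exists m, n = (a.+1 + m.+1)%N.
  by exists (n - a.+2)%N; lia.
set c : R := _ + 1; set q := _ / c; set p := _ / c.
have c0 : 0 < c by rewrite ltr_wpDl.
have cp : c * p = a.+2%:R - 1.
  by rewrite mulrC divfK ?gt_eqF// -[a.+2%:R]natr1 addrK.
have cq : c * q = a.+2%:R by rewrite mulrC divfK ?gt_eqF.
have p0 : 0 <= p by rewrite divr_ge0// ltW.
have pq : p <= q by rewrite ler_pM2r ?invr_gt0// ler_nat.
have q1 : q <= 1.
  by rewrite ler_pdivrMr// mul1r /c natr1 ler_nat; lia.
rewrite -lerN2 -(tail_barrier_left _ _ cp) -(tail_barrier_right _ _ cq).
apply: (@ler_hornerW _ p q); rewrite ?in_itv/= ?lexx ?pq// => t.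
rewrite in_itv/= => /andP[pt tq]; rewrite horner_deriv_tail_barrier mulr_ge0//.
  by rewrite mulrn_wge0// mulr_ge0// exprn_ge0//; lra.
(* The choice c = n + 1 places the roots of the quadratic exactly at [p] and [q]. *)
have -> : c * t * (1 - t) + (c * t - a.+2%:R) * (a.+1%:R - (a + m).+2%:R * t)
   - m.+1%:R * t = (c * t - c * p) * (c * q - c * t).
  by rewrite cp cq /c; ring.
by rewrite mulr_ge0// subr_ge0 ler_pM2l// ltW.
Qed.

Lemma binomial_tail_mode_step (R : rcfType) (n i : nat) :
  (i.+2 <= n)%N ->
  (binomial_tail R n i.+1).[i%:R / (n%:R - 1)] <=
  (binomial_tail R n i.+2).[i.+1%:R / (n%:R - 1)].
Proof.
move=> an; have [m ->] : exists m, n = (i.+1 + m.+1)%N.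
  by exists (n - i.+2)%N; lia.
have -> : (i.+1 + m.+1)%:R - 1 = (i + m).+1%:R :> R.
  by rewrite addSn addnS -natr1 addrK.
set c : R := (i + m).+1%:R; set p := _ / c; set q := _ / c.
have c0 : 0 < c by rewrite ltr0n.
have cp : c * p = i.+1%:R - 1.
  by rewrite mulrC divfK ?gt_eqF// -[i.+1%:R]natr1 addrK.
have cq : c * q = i.+1%:R by rewrite mulrC divfK ?gt_eqF.
have p0 : 0 <= p by rewrite divr_ge0// ltW.
have pq : p <= q by rewrite ler_pM2r ?invr_gt0// ler_nat.
have q1 : q <= 1 by rewrite ler_pdivrMr// mul1r ler_nat; lia.
rewrite -lerN2 -(tail_barrier_left _ _ cp) -(tail_barrier_right _ _ cq).
(* Here W decreases, so the monotonicity criterion is applied to -W. *)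
rewrite -lerN2 -!hornerN.
apply: (@ler_hornerW _ p q); rewrite ?in_itv/= ?lexx ?pq// => t.
rewrite in_itv/= => /andP[pt tq].
rewrite derivN hornerN horner_deriv_tail_barrier -mulrN mulr_ge0//.
  by rewrite mulrn_wge0// mulr_ge0// exprn_ge0//; lra.
have -> : - (c * t * (1 - t) + (c * t - i.+1%:R) *
    (i.+1%:R - (i + m).+2%:R * t) - m.+1%:R * t) =
    ((i + m).+2%:R * t - i.+1%:R) ^+ 2 + t * (1 - t).
  by rewrite /c; ring.
by rewrite addr_ge0 ?sqr_ge0// mulr_ge0//; lra.
Qed.

Lemma binomial_prob_ge (R : realType) (n k : nat) (p : R) : 0 <= p <= 1 ->
  binomial_prob n p [set j | (k <= j)%N] = ((binomial_tail R n k).[p])%:E.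
Proof.
move=> /andP[p0 p1]; rewrite (binomial_probE n (p0 := p0) p1).
rewrite /binomial_tail (big_nat_widenl _ _ _ _ _ (leq0n k)) big_mkord.
rewrite horner_sum -sumEFin [RHS]big_mkcond; apply: eq_bigr => j _.
have kjE : (nat_of_ord j \in [set i | (k <= i)%N]) = (k <= j)%N.
  by apply/idP/idP; rewrite inE.
rewrite diracE kjE /=.
case: (k <= j)%N; last by rewrite mule0.
by rewrite mule1 hornerMn hornerM !horner_exp hornerD hornerN hornerX hornerC.
Qed.

Theorem corollary11 (R : realType) (n : nat) (hn : (2 <= n)%N)
    (d : R -> measure_display) (T : forall p : R, measurableType (d p))
    (P : forall p : R, probability (T p) R)
    (B : forall p : R, {RV (P p) >-> nat})
    (hB : forall p : R, 0 <= p <= 1 -> binomial_rv n p (B p)) :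
  {in [set p : R | exists2 i : nat,
         (1 <= i <= n - 2)%N & p = i%:R / (n%:R - 1)] &,
    {homo (fun p : R => P p [set w | n%:R * p - p < (B p w)%:R]) :
       p q / p <= q >-> (p <= q)%E}} /\
  {in [set p : R | exists2 i : nat,
         (1 <= i <= n)%N & p = i%:R / (n%:R + 1)] &,
    {homo (fun p : R => P p [set w | n%:R * p - (1 - p) < (B p w)%:R]) :
       p q / p <= q >-> (q <= p)%E}}.
Proof.
(* On both grids the threshold is a natural number: n p - p = i at p = i / (n - 1), and n p - (1 -
   p) = i - 1 at p = i / (n + 1). Strict excess over k is the tail from k + 1. *)
have tailE (k : nat) (p x : R) : 0 <= p <= 1 -> x = k%:R ->
    P p [set w | x < (B p w)%:R] = (binomial_tail R n k.+1).[p]%:E.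
  move=> p01 ->; rewrite -binomial_prob_ge// -(hB _ p01).
  by congr (P p _); apply/seteqP; split=> w /=; rewrite ltr_nat.
split=> p q /set_mem[i hi ->] /set_mem[j hj ->].
  have n1 : 0 < n%:R - 1 :> R by rewrite subr_gt0 ltr1n.
  rewrite ler_pM2r ?invr_gt0// ler_nat => ij.
  have p01 l : (1 <= l <= n - 2)%N -> 0 <= (l%:R / (n%:R - 1) : R) <= 1.
    move=> hl; rewrite divr_ge0 ?(ltW n1)//= ler_pdivrMr// mul1r lerBrDr natr1.
    by rewrite ler_nat; lia.
  rewrite (@tailE i) ?(@tailE j) ?p01//; try by field; lra.
  rewrite lee_fin.
  pose F l : R := (binomial_tail R n l.+1).[l%:R / (n%:R - 1)].
  suff Fhomo : {in [pred l | 1 <= l <= n - 2]%N &,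
      {homo F : k l / (k <= l)%N >-> k <= l}} by exact: Fhomo.
  (* The admissible indices form an interval, so comparing consecutive grid points suffices. *)
  apply: (homo_leq_in (@lexx _ R)).
  - by move=> ? ? ?; exact: le_trans.
  - by move=> x y hx hy k; move: hx hy; rewrite !inE; lia.
  - move=> x hx hy; apply: binomial_tail_mode_step.
    by move: hx hy; rewrite !inE; lia.
have n1 : 0 < n%:R + 1 :> R by rewrite ltr_wpDl.
rewrite ler_pM2r ?invr_gt0// ler_nat => ij.
have p01 l : (1 <= l <= n)%N -> 0 <= (l%:R / (n%:R + 1) : R) <= 1.
  move=> hl; rewrite divr_ge0 ?(ltW n1)//= ler_pdivrMr// mul1r natr1.
  by rewrite ler_nat; lia.
(* Grid indices start at 1, so the threshold l - 1 is a true predecessor and the tail starts at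
   l. *)
have predE l : (1 <= l <= n)%N -> l.-1%:R = l%:R - 1 :> R.
  by case: l => // l _; rewrite -natr1 addrK.
rewrite (@tailE j.-1) ?(@tailE i.-1) ?p01 ?predE//; try by field; lra.
rewrite lee_fin !prednK; [|lia|lia].
pose F l : R := (binomial_tail R n l).[l%:R / (n%:R + 1)].
suff Fhomo : {in [pred l | 1 <= l <= n]%N &,
    {homo F : k l / (k <= l)%N >-> l <= k}} by exact: Fhomo.
(* The same reduction for the reversed order, since this half is decreasing. *)
apply: (homo_leq_in (r := fun x y : R => y <= x) (@lexx _ R)).
- by move=> y x z xy yz; exact: le_trans yz xy.
- by move=> x y hx hy k; move: hx hy; rewrite !inE; lia.
- move=> x hx hy; apply: binomial_tail_mean_step.
  by move: hx hy; rewrite !inE; lia.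
Qed.
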